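(* Let $S=(S_t)_{t\ge 0}$ be a strictly positive adapted process, let $\{a_k:k\in\mathbb{N}_0\}$ be a family of strictly positive real numbers, and assume that $\psi=(\psi_0,\psi_1,\ldots)$ is a positively homogeneous projection property (for the infinite time horizon) with $$\psi_k(S_{k+1}/S_k)\equiv a_k,\quad k\in\mathbb{N}_0 .$$ Let $\{z_k:k\in\mathbb{N}_0\}$ be a family of real numbers. There exists a strictly regular consumption process $X$ with the property $\psi$ (i.e. $X_k=\psi_k(X_{k+1})$ for all $k\in\mathbb{N}_0$) fulfilling $$X_k=z_kA_k,\quad k\in\mathbb{N}_0,$$ if and only if the following three conditions hold: $$0<z_0,$$ $$z_k=\frac{z_0}{\prod_{i=0}^{k-1}a_i-z_0\sum_{i=0}^{k-1}\prod_{j=i}^{k-1}a_j},\quad k\in\mathbb{N}_0,$$ and $$z_0<\frac{\prod_{i=0}^{k-1}a_i}{1+\sum_{i=0}^{k-1}\prod_{j=i}^{k-1}a_j},\quad k\in\mathbb{N}_0 .$$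
   Context: Let $(\Omega,\mathcal{F}_\infty,\mathbb{P})$ be a probability space with a filtration $(\mathcal{F}_t)_{t\ge 0}$; $\mathbb{N}_0=\{0,1,2,\ldots\}$. $S=(S_t)_{t\ge 0}$ is a strictly positive real-valued process adapted to $(\mathcal{F}_t)$ (money account without consumption). A consumption process is a real-valued process $X=(X_k)_{k\in\mathbb{N}_0}$ adapted to $(\mathcal{F}_k)_{k\in\mathbb{N}_0}$. The money account with consumption $A=(A_t)_{t\ge 0}$ associated with $S$ and $X$ is defined by $A_0=S_0$ and $A_t=(A_k-X_k)S_t/S_k$ for $k<t\le k+1$, $k\in\mathbb{N}_0$. $X$ is called strictly regular with respect to $S$ if $0<X_k<A_k$ for all $k\in\mathbb{N}_0$. Equalities and inequalities between random variables are understood pointwise; $\equiv$ means equality to a constant. Empty products are $1$ and empty sums are $0$. $L^0(\mathcal{F}_k)$ denotes the set of real-valued $\mathcal{F}_k$-measurable random variables, and $L^0_+(\mathcal{F}_k)$, $L^0_-(\mathcal{F}_k)$ the subsets of non-negative, respectively non-positive, ones. A positively homogeneous projection property for the infinite time horizon is a sequence $\psi=(\psi_0,\psi_1,\ldots)$ such that, for each $k\in\mathbb{N}_0$, $\psi_k$ is a mapping $L^0(\mathcal{F}_{k+1})\to L^0(\mathcal{F}_k)$ (not necessarily linear) which maps $L^0_+(\mathcal{F}_{k+1})$ into $L^0_+(\mathcal{F}_k)$ and $L^0_-(\mathcal{F}_{k+1})$ into $L^0_-(\mathcal{F}_k)$ and satisfies $\psi_k(YX)=Y\psi_k(X)$ for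 all $X\in L^0(\mathcal{F}_{k+1})$, $Y\in L^0_+(\mathcal{F}_k)$. A consumption process $X$ has the property $\psi$ if $X_k=\psi_k(X_{k+1})$ for all $k\in\mathbb{N}_0$. *)

(* Defs.v *)
From HB Require Import structures.
From mathcomp Require Import all_boot all_order all_algebra.
From mathcomp Require Import all_classical all_reals all_analysis.

Set Implicit Arguments.
Unset Strict Implicit.
Unset Printing Implicit Defensive.

Import Order.TTheory GRing.Theory Num.Theory.
Local Open Scope classical_set_scope.
Local Open Scope ring_scope.

Definition filtration (R : realType) d (T : measurableType d)
    (F : {nonneg R} -> set (set T)) : Prop :=
  [/\ forall t, sigma_algebra [set: T] (F t),
      forall t, F t `<=` measurable &
      forall s t, s <= t -> F s `<=` F t].

(* When G is a sigma-algebra, the measurable sets of [g_sigma_algebraType G]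
   are exactly the elements of G ([measurable_g_measurableTypeE]). *)
Definition L0 (R : realType) d (T : measurableType d) (G : set (set T)) :
    set (T -> R) :=
  [set f | measurable_fun setT (f : g_sigma_algebraType G -> R)].

Definition L0_nonneg (R : realType) d (T : measurableType d)
    (G : set (set T)) : set (T -> R) :=
  [set f | L0 G f /\ forall w, 0 <= f w].

Definition L0_nonpos (R : realType) d (T : measurableType d)
    (G : set (set T)) : set (T -> R) :=
  [set f | L0 G f /\ forall w, f w <= 0].

Definition adapted (R : realType) d (T : measurableType d)
    (F : {nonneg R} -> set (set T)) (S : {nonneg R} -> T -> R) : Prop :=
  forall t, L0 (F t) (S t).

Definition time (R : realType) (k : nat) : {nonneg R} := (k%:R : R)%:nng.
Arguments time {R} k.

Definition consumption_process (R : realType) d (T : measurableType d)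
    (F : {nonneg R} -> set (set T)) (X : nat -> T -> R) : Prop :=
  forall k, L0 (F (time k)) (X k).

Section MoneyAccount.
Context (R : realType) (T : Type).
Variables (S : {nonneg R} -> T -> R) (X : nat -> T -> R).

Fixpoint account_nat (k : nat) (w : T) : R :=
  if k is j.+1 then
    (account_nat j w - X j w) * S (time k) w / S (time j) w
  else S (time 0) w.

(* For 0 < t, the k with k < t <= k + 1 is the predecessor of the ceiling. *)
Definition account (t : {nonneg R}) (w : T) : R :=
  if t == time 0 then S (time 0) w else
  let k := `|Num.ceil t%:num|%N.-1 in
  (account_nat k w - X k w) * S t w / S (time k) w.

Lemma account0 w : account (time 0) w = S (time 0) w.
Proof. by rewrite /account eqxx. Qed.

Lemma account_index (k : nat) (t : {nonneg R}) :
  k%:R < t%:num <= k.+1%:R ->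
  (t == time 0) = false /\ `|Num.ceil t%:num|%N.-1 = k.
Proof.
move=> /andP[kt tk]; split.
  apply/negbTE/eqP => t0; move: kt; rewrite t0 /= => /(le_lt_trans (ler0n _ _)).
  by rewrite ltxx.
suff -> : Num.ceil t%:num = k.+1%:Z by [].
apply/eqP; rewrite ceil_eq -pmulrn tk andbT.
by rewrite -addn1 PoszD addrK -pmulrn.
Qed.

Lemma account_time k w : account (time k) w = account_nat k w.
Proof.
case: k => [|k]; first exact: account0.
have [|h1 h2] := @account_index k (time k.+1).
  by rewrite /= ltr_nat ltnSn lexx.
by rewrite /account h1 h2.
Qed.

Lemma accountE k t w : k%:R < t%:num <= k.+1%:R ->
  account t w = (account (time k) w - X k w) * S t w / S (time k) w.
Proof.
by move=> /account_index[h1 h2]; rewrite account_time /account h1 h2.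
Qed.

End MoneyAccount.

Definition strictly_regular (R : realType) (T : Type)
    (S : {nonneg R} -> T -> R) (X : nat -> T -> R) : Prop :=
  forall k w, 0 < X k w < account S X (time k) w.

(* Each psi k is a total function on T -> R, but only its restriction to
   L^0(F_{k+1}) is constrained here and used below. *)
Definition pos_homogeneous_projection_property (R : realType) d
    (T : measurableType d) (F : {nonneg R} -> set (set T))
    (psi : nat -> (T -> R) -> (T -> R)) : Prop :=
  forall k,
  [/\ forall X, L0 (F (time k.+1)) X -> L0 (F (time k)) (psi k X),
      forall X, L0_nonneg (F (time k.+1)) X ->
        L0_nonneg (F (time k)) (psi k X),
      forall X, L0_nonpos (F (time k.+1)) X ->
        L0_nonpos (F (time k)) (psi k X) &
      forall X Y, L0 (F (time k.+1)) X -> L0_nonneg (F (time k)) Y ->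
        psi k (Y \* X) = Y \* psi k X].

Definition has_property (R : realType) (T : Type)
    (psi : nat -> (T -> R) -> (T -> R)) (X : nat -> T -> R) : Prop :=
  forall k, X k = psi k (X k.+1).

(* Main.v *)
Require Import Defs.
From HB Require Import structures.
From mathcomp Require Import all_boot all_order all_algebra.
From mathcomp Require Import all_classical all_reals all_analysis.
From mathcomp Require Import measurable_realfun ring.
Import Order.TTheory GRing.Theory Num.Theory.
Local Open Scope classical_set_scope.
Local Open Scope ring_scope.

(* If X = z A then A_k = (1 - z_0) ... (1 - z_{k-1}) S_k, so strict regularity
   means 0 < z_k < 1, and positive homogeneity turns X_k = psi_k(X_{k+1}) into
   z_k = a_k z_{k+1} (1 - z_k). The denominators D_k of the explicit formula
   satisfy D_{k+1} = a_k (D_k - z_0), so z_k = z_0 / D_k solves this recursion,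
   and z_k < 1 becomes z_0 < D_k. *)

Lemma L0_sub (R : realType) d (T : measurableType d) (G H : set (set T)) :
  G `<=` H -> L0 (R := R) G `<=` L0 H.
Proof.
move=> GH f mf _ Y mY.
exact: sub_smallest2r GH _ (mf measurableT _ mY).
Qed.

Lemma L0_scale (R : realType) d (T : measurableType d) (G : set (set T))
    (c : R) f : L0 G f -> L0 G (fun w => c * f w).
Proof. by move=> mf; exact: measurable_funM. Qed.

Lemma L0_div (R : realType) d (T : measurableType d) (G : set (set T))
    (f g : T -> R) :
  L0 G f -> L0 G g -> (forall w, 0 < g w) -> L0 G (fun w => f w / g w).
Proof.
move=> mf mg g_gt0.
(* On positive values the inverse is the power with exponent -1, and [powR] with a fixed exponent is
   measurable. *)
rewrite (_ : (fun w => _) = f \* (fun w => g w `^ (- 1))); last first.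
  by apply/funext => w /=; rewrite powR_inv1 // ltW.
apply: measurable_funM => //.
exact: (measurableT_comp (measurable_powR _)) mg.
Qed.

Definition denom (R : realFieldType) (a : nat -> R) (x : R) (k : nat) : R :=
  \prod_(0 <= i < k) a i - x * \sum_(0 <= i < k) \prod_(i <= j < k) a j.

Arguments denom {R}.

Section Recursion.
Variables (R : realFieldType) (a : nat -> R).
Hypothesis a_gt0 : forall k, 0 < a k.

Lemma denomS x k : denom a x k.+1 = a k * (denom a x k - x).
Proof.
rewrite /denom big_nat_recr //= big_nat_recr //= big_nat1.
have -> : \sum_(0 <= i < k) \prod_(i <= j < k.+1) a j
    = (\sum_(0 <= i < k) \prod_(i <= j < k) a j) * a k.
  rewrite mulr_suml; apply: eq_big_nat => i /andP[_ /ltnW ik].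
  by rewrite big_nat_recr.
by ring.
Qed.

(** Positivity of the [a i] makes the divisor at least 1; clearing it and moving the multiple of [x]
    across gives the equivalence. *)
Lemma lt_denom x k :
  (x < \prod_(0 <= i < k) a i / (1 + \sum_(0 <= i < k) \prod_(i <= j < k) a j))
  = (x < denom a x k).
Proof.
rewrite ltr_pdivlMr ?ltrBrDr ?mulrDr ?mulr1 //.
rewrite ltr_wpDr // sumr_ge0 // => i _.
by rewrite prodr_ge0 // => j _; exact: ltW.
Qed.

Lemma recursion_solution (z : nat -> R) :
  (forall k, 0 < z k < 1) /\ (forall k, z k = a k * z k.+1 * (1 - z k)) <->
  [/\ 0 < z 0%N, forall k, z k = z 0%N / denom a (z 0%N) k &
      forall k, z 0%N < denom a (z 0%N) k].
Proof.
set x := z 0%N; split=> [[z01 zS]|[x_gt0 zE x_lt]].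
  have x_gt0 : 0 < x by case/andP: (z01 0%N).
  (* The product form is proved first, as division needs [denom a x k] to be nonzero; its positivity
     is then read off from [0 < x] and [0 < z k]. *)
  have zE k : x = z k * denom a x k.
    elim: k => [|k IHk].
      by rewrite /denom !big_geq // mulr0 subr0 mulr1.
    have /andP[_ zk1] := z01 k.
    have zk1' : 1 - z k != 0 by rewrite gt_eqF // subr_gt0.
    (* The factor [1 - z k] completes [a k * z k.+1] to the right side of the recursion, which is
       [z k]. *)
    apply: (mulIf zk1'); rewrite denomS.
    have -> : z k.+1 * (a k * (denom a x k - x)) * (1 - z k) =
      (a k * z k.+1 * (1 - z k)) * (denom a x k - x) by ring.
    by rewrite -zS [RHS]mulrBr -IHk; ring.
  have D_gt0 k : 0 < denom a x k.
    by have /andP[zk0 _] := z01 k; rewrite -(pmulr_rgt0 _ zk0) -zE.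
  split=> // k; first by apply: (canRL (mulfK _)); rewrite ?gt_eqF -?zE.
  by have /andP[_ zk1] := z01 k; rewrite {1}(zE k) gtr_pMl.
have D_gt0 k : 0 < denom a x k by exact: lt_trans (x_lt k).
split=> k; first by rewrite zE divr_gt0 //= ltr_pdivrMr ?mul1r.
rewrite (zE k.+1) (zE k) denomS; field.
(* The divisors to keep away from zero include [denom a x k - x], positive by [x_lt]. *)
by apply/and3P; split; rewrite gt_eqF // subr_gt0.
Qed.

End Recursion.

(** Consuming the fraction [z i] leaves the factor [1 - z i], while the growth ratios of [S]
    telescope. The outcome [w] is fixed throughout. *)
Lemma account_nat_proportional (R : realType) (T : Type)
    (S : {nonneg R} -> T -> R) (X : nat -> T -> R) (z : nat -> R) k w :
  (forall t w, 0 < S t w) ->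
  (forall k, X k w = z k * account_nat S X k w) ->
  account_nat S X k w = \prod_(0 <= i < k) (1 - z i) * S (time k) w.
Proof.
move=> S_gt0 XE; elim: k => [|k IHk]; first by rewrite big_geq // mul1r.
rewrite /= XE IHk big_nat_recr //=; field.
by rewrite gt_eqF.
Qed.

Section Projection.
Context (R : realType) (d : measure_display) (T : measurableType d).
Context (F : {nonneg R} -> set (set T)) (F_filtration : filtration F).
Context (S : {nonneg R} -> T -> R) (S_adapted : adapted F S).
Hypothesis S_gt0 : forall t w, 0 < S t w.
Context (psi : nat -> (T -> R) -> (T -> R)).
Hypothesis psi_proj : pos_homogeneous_projection_property F psi.

(** Writing the argument as [c * S (time k)] times the growth ratio, positive homogeneity pulls out
    the first factor, which is measurable at time [k] and non-negative because [0 <= c]. *)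
Lemma psi_scaled_account k (a c : R) :
  psi k (fun w => S (time k.+1) w / S (time k) w) = (fun=> a) -> 0 <= c ->
  psi k (fun w => c * S (time k.+1) w) = (fun w => a * c * S (time k) w).
Proof.
move=> psi_S c_ge0; have [_ _ F_mono] := F_filtration.
have [_ _ _ psiM] := psi_proj k.
pose Y w := c * S (time k) w.
rewrite (_ : (fun w => _) =
    Y \* (fun w => S (time k.+1) w / S (time k) w)); last first.
  by apply/funext => w /=; rewrite /Y; field; rewrite gt_eqF.
rewrite psiM ?psi_S; first by apply/funext => w /=; rewrite /Y; ring.
  apply: L0_div => //; apply: L0_sub (S_adapted (time k)).
  by apply: F_mono; rewrite -num_le /= ler_nat.
split; first exact: L0_scale.
by move=> w; rewrite mulr_ge0 // ltW.
Qed.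

End Projection.

Theorem proposition4 (R : realType) (d : measure_display)
    (T : measurableType d) (P : probability T R)
    (F : {nonneg R} -> set (set T)) (F_filtration : filtration F)
    (S : {nonneg R} -> T -> R) (S_adapted : adapted F S)
    (S_gt0 : forall t w, 0 < S t w)
    (a : nat -> R) (a_gt0 : forall k, 0 < a k)
    (psi : nat -> (T -> R) -> (T -> R))
    (psi_proj : pos_homogeneous_projection_property F psi)
    (psi_S : forall k,
       psi k (fun w => S (time k.+1) w / S (time k) w) = (fun=> a k))
    (z : nat -> R) :
  (exists X : nat -> T -> R,
     [/\ consumption_process F X,
         strictly_regular S X,
         has_property psi X &
         forall k w, X k w = z k * account S X (time k) w]) <->
  [/\ 0 < z 0%N,
      forall k : nat, z k = z 0%N /
        (\prod_(0 <= i < k) a i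
         - z 0%N * \sum_(0 <= i < k) \prod_(i <= j < k) a j) &
      forall k : nat, z 0%N <
        (\prod_(0 <= i < k) a i) /
        (1 + \sum_(0 <= i < k) \prod_(i <= j < k) a j)].
Proof.
have -> : [/\ 0 < z 0%N,
    forall k : nat, z k = z 0%N /
      (\prod_(0 <= i < k) a i
       - z 0%N * \sum_(0 <= i < k) \prod_(i <= j < k) a j) &
    forall k : nat, z 0%N <
      (\prod_(0 <= i < k) a i) /
      (1 + \sum_(0 <= i < k) \prod_(i <= j < k) a j)] <->
  [/\ 0 < z 0%N, forall k, z k = z 0%N / denom a (z 0%N) k &
      forall k, z 0%N < denom a (z 0%N) k].
  by split=> -[z0 zE z_lt]; split=> // k; have := z_lt k; rewrite lt_denom.
rewrite -recursion_solution //.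
(* [c k] is the ratio of the account with consumption to the one without. *)
pose c k := \prod_(0 <= i < k) (1 - z i).
have cS k : c k.+1 = c k * (1 - z k) by rewrite /c big_nat_recr.
have c_gt0 k : (forall i, 0 < z i < 1) -> 0 < c k.
  by move=> z01; apply: prodr_gt0 => i _; have /andP[_] := z01 i;
    rewrite subr_gt0.
have accE X k w : (forall k, X k w = z k * account S X (time k) w) ->
    account S X (time k) w = c k * S (time k) w.
  move=> XE; rewrite account_time; apply: account_nat_proportional => // j.
  by rewrite XE account_time.
have psiE k : (forall i, 0 < z i < 1) ->
    psi k (fun w => z k.+1 * c k.+1 * S (time k.+1) w) =
    (fun w => a k * (z k.+1 * c k.+1) * S (time k) w).
  move=> z01; apply: (psi_scaled_account _ _ _ _ F_filtration S S_adapted) => //.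
  by have /andP[zk0 _] := z01 k.+1; rewrite ltW ?mulr_gt0 ?c_gt0.
split=> [[X [_ X_reg X_psi XE]]|[z01 zS]].
  have z01 k : 0 < z k < 1.
    (* The [z k] are constants, so evaluating at the single outcome [point] suffices, here and for
       the recursion below. *)
    have /andP[X_gt0 X_lt] := X_reg k point.
    have A_gt0 := lt_trans X_gt0 X_lt.
    by move: X_gt0 X_lt; rewrite XE pmulr_lgt0 // gtr_pMl // => -> ->.
  split=> // k.
  have XcE j : X j = (fun w => z j * c j * S (time j) w).
    by apply/funext => w; rewrite XE accE // mulrA.
  have := X_psi k; rewrite !XcE psiE // => /(congr1 (@^~ point)) /=.
  rewrite cS; set s := S _ _ => eq_s.
  have cs_neq0 : c k * s != 0 by rewrite gt_eqF // mulr_gt0 ?c_gt0 ?S_gt0.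
  by apply: (mulIf cs_neq0); rewrite mulrA eq_s; ring.
(* This witness is forced, since [accE] leaves [c k * S (time k) w] as the only possible account
   value. *)
pose X k w := z k * c k * S (time k) w.
have XE k w : X k w = z k * account S X (time k) w.
  (* [accE] presupposes the proportionality being proved, so the account of this [X] is computed by
     a direct induction. *)
  rewrite account_time /X -mulrA; congr (_ * _).
  elim: k => [|k IHk] /=; first by rewrite /c big_geq // mul1r.
  by rewrite -IHk cS /X; field; rewrite gt_eqF.
exists X; split=> //.
- by move=> k; exact: L0_scale.
- move=> k w; have /andP[zk0 zk1] := z01 k.
  have A_gt0 : 0 < account S X (time k) w by rewrite accE // mulr_gt0 ?c_gt0.
  by rewrite XE mulr_gt0 //= gtr_pMl.
- move=> k; rewrite /X psiE //; apply/funext => w.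
  (* Only the leading [z k] is expanded by the recursion; its factor [1 - z k] matches the one that
     [cS] produces. *)
  by rewrite cS {1}zS; ring.
Qed.
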